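(* Let $\mathbb{D}$ be a discrete valuation ring with uniformizer $z$, let $R\subset\mathbb{D}$ be a complete set of coset representatives of $\mathbb{D}$ over $z\mathbb{D}$ with $0\in R$, and consider a causal $\mathbb{D}$-linear network code on a (possibly cyclic) network with $\omega$ source channels. Let $v$ be any node and $\delta\ge 0$ an integer. Write $[\mathbf{f}_e]_{e\in In(v)}=\sum_{j\ge0}z^jF_j$ with the $F_j$ matrices over $R$; for each source data vector $\mathbf{m}\in\mathbb{D}^\omega$ (row vector) write $\mathbf{m}=\sum_{j\ge0}z^jm_j$ and $\mathbf{r}=\mathbf{m}\cdot[\mathbf{f}_e]_{e\in In(v)}=\sum_{j\ge0}z^jr_j$ with $m_j,r_j$ row vectors over $R$. Then the following are equivalent: (a) (Time-invariant decodability with delay $\delta$.) There is an $|In(v)|\times\omega$ matrix $\mathbf{A}$ over $\mathbb{D}$ with $[\mathbf{f}_e]_{e\in In(v)}\cdot\mathbf{A}=z^\delta\mathbf{I}$. (b) (Time-variant decodability with delay $\delta$.) For every $t\ge0$ there are $|In(v)|\times\omega$ matrices $A_{t,0},\dots,A_{t,t+\delta}$ over $R$, derivable from $F_0,\dots,F_{t+\delta}$ (in particular not depending on $\mathbf{m}$), such that for all $\mathbf{m}\in\mathbb{D}^\omega$ $$\sum_{j=0}^t z^{j+\delta}m_j\equiv\Big(\sum_{j=0}^{t+\delta}z^jr_j\Big)\cdot\Big(\sum_{j=0}^{t+\delta}z^jA_{t,j}\Big)\pmod{z^{t+\delta+1}}.$$ (c) ($\mathbb{D}$-linear calculation of $m_0$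 from $r_0,\dots,r_\delta$ and $F_0,\dots,F_\delta$.) There are $|In(v)|\times\omega$ matrices $A_0,\dots,A_\delta$ over $R$, derivable from $F_0,\dots,F_\delta$ (in particular not depending on $\mathbf{m}$), such that for all $\mathbf{m}\in\mathbb{D}^\omega$ $$z^\delta m_0\equiv\Big(\sum_{j=0}^{\delta}z^jr_j\Big)\cdot\Big(\sum_{j=0}^{\delta}z^jA_j\Big)\pmod{z^{\delta+1}}.$$
   Context: A discrete valuation ring (DVR) is a local principal ideal domain that is not a field; its uniformizer $z$ generates the unique maximal ideal. Network: a finite directed multigraph (cycles allowed) whose edges are called channels, with a distinguished source node having exactly $\omega\ge 1$ outgoing channels (the source channels). $In(v)$ is the set of incoming channels of a node $v$. An adjacent pair $(d,e)$ consists of a channel $d$ ending at the node from which the channel $e$ starts. A $\mathbb{D}$-linear network code ($\mathbb{D}$-LNC) assigns a coding coefficient $k_{d,e}\in\mathbb{D}$ to every adjacent pair $(d,e)$. It is causal if around every cycle of the network there is at least one adjacent pair $(d,e)$ with $k_{d,e}$ divisible by $z$. Causality guarantees a unique assignment of coding vectors $\mathbf{f}_e\in\mathbb{D}^\omega$ (column vectors) to the channels $e$ such that the coding vectors of the $\omega$ source channels form the natural basis of $\mathbb{D}^\omega$ and $\mathbf{f}_e=\sum_{d\in In(v)}k_{d,e}\mathbf{f}_d$ for every outgoing channel $e$ of every non-source node $v$. $[\mathbf{f}_e]_{e\in In(v)}$ denotes the $\omega\times|In(v)|$ matrix with columns $\mathbf{f}_e$, $e\in In(v)$, and $\mathbf{I}$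 is the $\omega\times\omega$ identity matrix. Power series expression: every $x\in\mathbb{D}$ is uniquely of the form $\sum_{t\ge0}a_tz^t$ with $a_t\in R$, meaning $x\equiv\sum_{t=0}^{k-1}a_tz^t \pmod{z^k}$ for all $k\ge 0$. Applied entrywise, every matrix $\mathbf{M}$ over $\mathbb{D}$ is uniquely $\sum_{j\ge0}z^jM_j$ with each $M_j$ a matrix over $R$. Congruences of vectors or matrices modulo $z^k$ are entrywise modulo $z^k\mathbb{D}$. On ''derivable'': for fixed $t$, the congruence in (b), required for all $\mathbf{m}$, involves the code only through $F_0,\dots,F_{t+\delta}$ (because $r_0,\dots,r_{t+\delta}$ are determined by $m_0,\dots,m_{t+\delta}$ and $F_0,\dots,F_{t+\delta}$), so derivability amounts to the existence of such matrices that work for all $\mathbf{m}$ simultaneously; likewise for (c) with $\delta$ in place of $t+\delta$. *)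

(* Defs.v *)
From HB Require Import structures.
From mathcomp Require Import all_boot all_order all_algebra.

Set Implicit Arguments.
Unset Strict Implicit.
Unset Printing Implicit Defensive.

Import GRing.Theory.
Local Open Scope ring_scope.

Section DVR.
Variable D : idomainType.
Implicit Types (I J : D -> Prop) (x z : D).

(* MathComp has no divisibility relation on an arbitrary integral domain. *)
Definition divides z x : Prop := exists y, x = y * z.

Definition is_ideal I : Prop :=
  [/\ I 0, forall x y, I x -> I y -> I (x + y) & forall a x, I x -> I (a * x)].

Definition generates z I : Prop := forall x, I x <-> divides z x.

Definition is_maximal_ideal I : Prop :=
  [/\ is_ideal I, ~ I 1 &
      forall J, is_ideal J -> ~ J 1 ->
        (forall x, I x -> J x) -> forall x, J x -> I x].

(* Ideals are compared extensionally, so no axiom is needed for uniqueness. *)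
Definition is_local : Prop :=
  exists2 I, is_maximal_ideal I &
    forall J, is_maximal_ideal J -> forall x, J x <-> I x.

Definition is_PID : Prop := forall I, is_ideal I -> exists z, generates z I.

Definition is_field : Prop := forall x, x != 0 -> x \is a GRing.unit.

Definition is_DVR : Prop := [/\ is_local, is_PID & ~ is_field].

Definition is_uniformizer z : Prop :=
  exists2 I, is_maximal_ideal I & generates z I.

Definition complete_representatives z (R : D -> Prop) : Prop :=
  forall x, exists! a, R a /\ divides z (x - a).

End DVR.

Section PowerSeries.
Variables (D : idomainType) (z : D) (R : D -> Prop) (m n : nat).

Definition mx_over (M : 'M[D]_(m, n)) : Prop := forall i j, R (M i j).

Definition mx_congr (k : nat) (M N : 'M[D]_(m, n)) : Prop :=
  forall i j, divides (z ^+ k) (M i j - N i j).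

Definition is_expansion (M : 'M[D]_(m, n)) (Mc : nat -> 'M[D]_(m, n)) : Prop :=
  (forall t, mx_over (Mc t)) /\
  (forall k, mx_congr k M (\sum_(t < k) z ^+ t *: Mc t)).

End PowerSeries.

(* The indexing of the source channels by 'I_omega fixes which natural basis
   vector each of them carries. *)
Record network (omega : nat) := Network {
  node : finType;
  channel : finType;
  tail : channel -> node;
  head : channel -> node;
  source : node;
  source_channel : 'I_omega -> channel;
  source_channel_inj : injective source_channel;
  source_channelP :
    forall e, (tail e == source) = (e \in codom source_channel)
}.

Section LNC.
Variables (D : idomainType) (z : D) (omega : nat) (N : network omega).

Definition In (v : node N) : {set channel N} := [set e | head e == v].

Definition adjacent (d e : channel N) : bool := head d == tail e.

(* A code is represented by a total function k; its values on pairs that are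
   not adjacent are never used. *)
Implicit Type k : channel N -> channel N -> D.

(* Cycles are closed walks without repeated channel, but possibly with repeated
   nodes. With node-simple cycles only, the coding vectors could fail to be
   unique: take two loops a, b at a node with k a b * k b a = 1 and
   k a a = k b b = 0. *)
Definition causal k : Prop :=
  forall c : seq (channel N), c != [::] -> ucycle adjacent c ->
    exists2 d, d \in c & divides z (k d (next c d)).

Definition coding_vectors k (f : channel N -> 'cV[D]_omega) : Prop :=
  (forall i, f (source_channel N i) = delta_mx i 0) /\
  (forall e, tail e != source N ->
     f e = \sum_(d in In (tail e)) k d e *: f d).

Definition incoming_mx (f : channel N -> 'cV[D]_omega) (v : node N) :
    'M[D]_(omega, #|In v|) :=
  \matrix_(i, j) f (enum_val j) i 0.

End LNC.

Section Decodability.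
Variables (D : idomainType) (z : D) (R : D -> Prop) (omega n : nat).
Variable M : 'M[D]_(omega, n).

Definition time_invariant_decodable (delta : nat) : Prop :=
  exists A : 'M[D]_(n, omega), M *m A = z ^+ delta *: 1%:M.

(* Here and below, A is chosen before the data vector m. *)
Definition time_variant_decodable (delta : nat) : Prop :=
  forall t : nat, exists A : 'I_(t + delta).+1 -> 'M[D]_(n, omega),
    (forall j, mx_over R (A j)) /\
    forall (m : 'rV[D]_omega) (mc : nat -> 'rV[D]_omega)
           (rc : nat -> 'rV[D]_n),
      is_expansion z R m mc -> is_expansion z R (m *m M) rc ->
      mx_congr z (t + delta).+1
        (\sum_(j < t.+1) z ^+ (j + delta) *: mc j)
        ((\sum_(j < (t + delta).+1) z ^+ j *: rc j) *m
         (\sum_(j < (t + delta).+1) z ^+ j *: A j)).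

Definition initial_decodable (delta : nat) : Prop :=
  exists A : 'I_delta.+1 -> 'M[D]_(n, omega),
    (forall j, mx_over R (A j)) /\
    forall (m : 'rV[D]_omega) (mc : nat -> 'rV[D]_omega)
           (rc : nat -> 'rV[D]_n),
      is_expansion z R m mc -> is_expansion z R (m *m M) rc ->
      mx_congr z delta.+1
        (z ^+ delta *: mc 0%N)
        ((\sum_(j < delta.+1) z ^+ j *: rc j) *m
         (\sum_(j < delta.+1) z ^+ j *: A j)).

End Decodability.

(* Main.v *)
(** Modulo [z ^ delta.+1], the calculation of [m_0] says that some matrix [A']
    satisfies [M A' = z ^ delta (I + z B)], where [M] is the matrix of incoming
    coding vectors.  Since [D] is local, [I + z B] is invertible: its determinant
    is congruent to 1 modulo [z].  Hence [A' (I + z B)^-1] decodes with delay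
    [delta].  Conversely, truncating the power series expansion of a
    time-invariant decoder yields the time-variant ones. *)

Require Import Defs.
From HB Require Import structures.
From mathcomp Require Import all_boot all_order all_algebra.
From mathcomp Require Import boolp.

Set Implicit Arguments.
Unset Strict Implicit.
Unset Printing Implicit Defensive.

Import GRing.Theory.
Local Open Scope ring_scope.

Section Ideals.
Variable D : idomainType.
Implicit Types (x y z g : D) (I J : D -> Prop).

Lemma divides_refl x : divides x x.
Proof. by exists 1; rewrite mul1r. Qed.

Lemma divides_trans x y z : divides x y -> divides y z -> divides x z.
Proof. by move=> [a ->] [b ->]; exists (b * a); rewrite mulrA. Qed.

Lemma divides_ideal g : is_ideal (divides g).
Proof.
split.
- by exists 0; rewrite mul0r.
- by move=> x y [a ->] [b ->]; exists (a + b); rewrite mulrDl.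
- by move=> a x [b ->]; exists (a * b); rewrite mulrA.
Qed.

Lemma divides1_unit x : divides x 1 -> x \is a GRing.unit.
Proof. by move=> [y xy]; apply/unitrPr; exists y; rewrite mulrC -xy. Qed.

(** If no such [h] existed, the generator of any proper ideal containing [g] would be a multiple of
    [g], which is exactly maximality. *)
Lemma not_maximal_divides g :
  is_PID D -> ~ divides g 1 -> ~ is_maximal_ideal (divides g) ->
  exists h, [/\ ~ divides h 1, divides h g & ~ divides g h].
Proof.
move=> hPID g1 gmax; apply: contrapT => noh; apply: gmax.
split=> // [|J iJ J1 gJ x Jx]; first exact: divides_ideal.
have [h hJ] := hPID J iJ.
apply: contrapT => gx; apply: noh; exists h; split.
- by move=> /hJ.
- by apply/hJ/gJ/divides_refl.
- by move=> gh; apply/gx/(divides_trans gh)/hJ.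
Qed.

(* Otherwise there is a strictly increasing chain of proper principal ideals
   containing [x]; a generator of the union lies in one of them. *)
Lemma PID_maximal_ideal x :
  is_PID D -> ~ divides x 1 -> exists2 g, is_maximal_ideal (divides g) & divides g x.
Proof.
move=> hPID x1; apply: contrapT => nomax.
(* The hypotheses on [g] stay inside the existential so that [choice] yields a total function; where
   they fail, the value 0 is a dummy. *)
have step g : exists h, ~ divides g 1 -> divides g x ->
    [/\ ~ divides h 1, divides h g & ~ divides g h].
  have [[g1 gx]|ng] := pselect (~ divides g 1 /\ divides g x); last first.
    by exists 0 => g1 gx; case: ng.
  have [|h hP] := @not_maximal_divides g hPID g1; last by exists h.
  by move=> gmax; apply: nomax; exists g.
have [F FP] := choice step.
pose u n := iter n F x.
have uP n : ~ divides (u n) 1 /\ divides (u n) x.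
  elim: n => [|n [u1 ux]] /=; first by split=> //; exact: divides_refl.
  by have [? Fu _] := FP _ u1 ux; split=> //; exact: divides_trans Fu ux.
have uS n : divides (u n.+1) (u n) /\ ~ divides (u n) (u n.+1).
  by have [u1 ux] := uP n; have [] := FP _ u1 ux.
have u_le m n : (m <= n)%N -> divides (u n) (u m).
  elim: n => [|n IHn]; first by rewrite leqn0 => /eqP ->; exact: divides_refl.
  rewrite leq_eqVlt => /orP[/eqP ->|mn]; first exact: divides_refl.
  exact: divides_trans (uS n).1 (IHn mn).
have iJ : is_ideal (fun y => exists n, divides (u n) y).
  split; first by exists 0%N; have [] := divides_ideal (u 0%N).
  - move=> y y' [n ny] [n' ny']; exists (maxn n n').
    have [_ add _] := divides_ideal (u (maxn n n')).
    apply: add.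
      by apply: divides_trans ny; apply: u_le; rewrite leq_maxl.
    by apply: divides_trans ny'; apply: u_le; rewrite leq_maxr.
  - by move=> a y [n ny]; exists n; have [_ _] := divides_ideal (u n); apply.
have [h hJ] := hPID _ iJ.
have [n nh] : exists n, divides (u n) h by apply/hJ/divides_refl.
apply: (uS n).2; apply: divides_trans nh _.
by apply/hJ; exists n.+1; exact: divides_refl.
Qed.

(** A non-unit lies in some maximal ideal, which by locality is the one generated by [z]; that ideal
    would then contain 1. *)
Lemma unit_1Dz z y : is_local D -> is_PID D -> is_uniformizer z ->
  1 + y * z \is a GRing.unit.
Proof.
move=> [I0 _ I0u] hPID [I maxI zI]; apply: divides1_unit.
apply: contrapT => x1.
have [g gmax gx] := PID_maximal_ideal hPID x1.
have /zI[a xa] : I (1 + y * z) by apply/(I0u _ maxI)/(I0u _ gmax).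
have [_ + _] := maxI; apply; apply/zI.
by exists (a - y); rewrite mulrBl -xa addrK.
Qed.

End Ideals.

Section Congruences.
Variables (D : idomainType) (z : D).

Lemma mx_congrP m n k (M N : 'M[D]_(m, n)) :
  mx_congr z k M N <-> exists B, M = N + z ^+ k *: B.
Proof.
split=> [MN|[B ->] i j]; last first.
  by exists (B i j); rewrite !mxE addrAC subrr add0r mulrC.
have [B BP] := choice (fun p : 'I_m * 'I_n => MN p.1 p.2).
exists (\matrix_(i, j) B (i, j)); apply/matrixP=> i j.
by rewrite !mxE mulrC -(BP (i, j)) addrC subrK.
Qed.

(** With [z] replaced by an indeterminate, the determinant becomes a polynomial with value 1 at 0,
    so the factor theorem splits off the variable. *)
Lemma det_1Dz n (B : 'M[D]_n) : exists y, \det (1%:M + z *: B) = 1 + y * z.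
Proof.
pose P := 1%:M + 'X *: map_mx polyC B.
have detP x : (\det P).[x] = \det (1%:M + x *: B).
  (* Evaluation at [x] is a ring morphism, hence commutes with the determinant. *)
  rewrite -[_.[x]]/(horner_eval x _) -det_map_mx; congr (\det _).
  apply/matrixP=> i j; rewrite !mxE rmorphD rmorphM rmorph_nat /=.
  by rewrite /horner_eval hornerX hornerC.
have /factor_theorem[q qE] : root (\det P - (\det P).[0]%:P) 0.
  by apply/rootP; rewrite hornerD hornerN hornerC subrr.
exists q.[z]; rewrite -detP -[\det P](subrK (\det P).[0]%:P) qE.
rewrite hornerD hornerM hornerXsubC subr0 hornerC detP scale0r addr0 det1.
by rewrite addrC.
Qed.

Variables (R : D -> Prop).
Hypothesis hR : complete_representatives z R.

(** The digits come from repeated division by [z]: [d x] pairs the representative of [x] with the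
    quotient, and [rest t x] is the quotient after [t] divisions. *)
Lemma expansion_exists m n (M : 'M[D]_(m, n)) : exists Mc, is_expansion z R M Mc.
Proof.
have digit x : exists p : D * D, R p.1 /\ x = p.1 + p.2 * z.
  have [a [[Ra [y xa]] _]] := hR x.
  by exists (a, y); split=> //=; rewrite -xa addrC subrK.
have [d dP] := choice digit.
pose rest t x := iter t (fun y => (d y).2) x.
have restP k x : x = \sum_(t < k) z ^+ t * (d (rest t x)).1 + rest k x * z ^+ k.
  elim: k => [|k IHk]; first by rewrite big_ord0 add0r mulr1.
  have [_ restE] := dP (rest k x).
  rewrite {1}IHk {1}restE mulrDl addrA big_ord_recr /=.
  by rewrite exprS mulrA [z ^+ k * _]mulrC.
exists (fun t => map_mx (fun x => (d (rest t x)).1) M); split.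
  by move=> t i j; rewrite mxE; have [] := dP (rest t (M i j)).
move=> k i j; exists (rest k (M i j)).
rewrite {1}(restP k (M i j)) summxE addrC.
under [X in - X]eq_bigr do rewrite !mxE.
by rewrite addKr.
Qed.

End Congruences.

Section Decodability.
Variables (D : idomainType) (z : D) (R : D -> Prop).
Hypotheses (hD : is_DVR D) (hz : is_uniformizer z).
Hypothesis hR : complete_representatives z R.
Variables (omega n : nat) (M : 'M[D]_(omega, n)) (delta : nat).

Lemma time_invariant_variant :
  time_invariant_decodable z M delta -> time_variant_decodable z R M delta.
Proof.
move=> [A MA] t; have [Ac [RA EA]] := expansion_exists hR A.
exists (fun j => Ac j); split=> // m mc rc [_ Em] [_ Er].
have [Bm mE] := (mx_congrP _ _ _ _).1 (Em t.+1).
have [Br rE] := (mx_congrP _ _ _ _).1 (Er (t + delta).+1).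
have [BA AE] := (mx_congrP _ _ _ _).1 (EA (t + delta).+1).
set S := \sum_(j < _) z ^+ j *: rc j in rE *.
set SA := \sum_(j < _) z ^+ j *: Ac j in AE *.
(* The witness collects the truncation errors in [r A = z ^ delta m]: those of [A], of [r], and of
   [m], the last one scaled by [z ^ delta]. *)
apply/mx_congrP; exists (S *m BA + Br *m A - Bm).
have -> : \sum_(j < t.+1) z ^+ (j + delta) *: mc j
        = z ^+ delta *: (m - z ^+ t.+1 *: Bm).
  rewrite mE addrK scaler_sumr; apply: eq_bigr => j _.
  by rewrite scalerA -exprD addnC.
have : (m *m M) *m A = z ^+ delta *: m by rewrite -mulmxA MA -scalemxAr mulmx1.
rewrite scalerBr => <-.
rewrite rE mulmxDl {1}AE mulmxDr scalerA -exprD addnS [(delta + t)%N]addnC.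
by rewrite -scalemxAl -scalemxAr scalerBr scalerDr !addrA.
Qed.

Lemma time_variant_initial :
  time_variant_decodable z R M delta -> initial_decodable z R M delta.
Proof.
move=> /(_ 0%N)[A [RA AP]]; exists A; split=> // m mc rc Em Er.
by have := AP m mc rc Em Er; rewrite big_ord1.
Qed.

Lemma initial_time_invariant :
  initial_decodable z R M delta -> time_invariant_decodable z M delta.
Proof.
move=> [Ac [_ AP]]; set A := \sum_(j < _) _ in AP.
have /mx_congrP[B MA] : mx_congr z delta.+1 (M *m A) (z ^+ delta *: 1%:M).
  move=> i j.
  (* The data vector [delta_mx 0 i] reads off row [i] of [M *m A]. Its leading digit [mc 0] may
     differ from it, as 1 need not lie in [R]; the difference [z *: B2] is absorbed modulo
     [z ^ delta.+1] after scaling by [z ^ delta]. *)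
  have [mc Em] := expansion_exists hR (delta_mx 0 i : 'rV_omega).
  have [rc Er] := expansion_exists hR ((delta_mx 0 i : 'rV_omega) *m M).
  have [B1 m0E] := (mx_congrP _ _ _ _).1 (AP _ _ _ Em Er).
  have [B2] := (mx_congrP _ _ _ _).1 (Em.2 1%N).
  rewrite big_ord1 expr0 scale1r expr1 => mE.
  have [B3 rE] := (mx_congrP _ _ _ _).1 (Er.2 delta.+1).
  have : row i (M *m A) = row i (z ^+ delta *: 1%:M)
       + z ^+ delta.+1 *: (B3 *m A - B1 - B2).
    rewrite rowE mulmxA rE mulmxDl -scalemxAl.
    rewrite [row i (_ *: _)]rowE -scalemxAr mulmx1 [in RHS]mE scalerDr m0E.
    rewrite scalerA -exprSr !scalerBr -[_ + _ + z ^+ _ *: B2]addrA.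
    by rewrite -[_ - _ - _]addrA -opprD [RHS]addrACA subrr addr0.
  move: (M *m A) (_ *: 1%:M) (_ - B2) => P Q C /rowP/(_ j).
  by rewrite !mxE => ->; exists (C 0 j); rewrite addrAC subrr add0r mulrC.
have [[hloc hPID _] [y detE]] := (hD, det_1Dz z B).
have uB : 1%:M + z *: B \in unitmx by rewrite unitmxE detE unit_1Dz.
(* Here [M *m A] equals [z ^ delta *: (1%:M + z *: B)], and the inverse cancels the second
   factor. *)
exists (A *m invmx (1%:M + z *: B)).
rewrite mulmxA MA exprSr -scalerA -scalerDr -scalemxAl.
by rewrite mulmxV.
Qed.

End Decodability.

Theorem theorem7 (D : idomainType) (z : D) (R : D -> Prop)
    (hD : is_DVR D) (hz : is_uniformizer z)
    (hR : complete_representatives z R) (hR0 : R 0)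
    (omega : nat) (homega : (1 <= omega)%N) (N : network omega)
    (k : channel N -> channel N -> D) (hk : causal z k)
    (f : channel N -> 'cV[D]_omega) (hf : coding_vectors k f)
    (v : node N) (delta : nat) :
  (time_invariant_decodable z (incoming_mx f v) delta <->
   time_variant_decodable z R (incoming_mx f v) delta) /\
  (time_variant_decodable z R (incoming_mx f v) delta <->
   initial_decodable z R (incoming_mx f v) delta).
Proof.
have ab := @time_invariant_variant D z R hR _ _ (incoming_mx f v) delta.
have bc := @time_variant_initial D z R _ _ (incoming_mx f v) delta.
have ca := @initial_time_invariant D z R hD hz hR _ _ (incoming_mx f v) delta.
by split; [split=> // /bc/ca|split=> // /ca/ab].
Qed.
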